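(* Let $k,\rho,c,\ell,\gamma,D_\infty,h_0>0$ and $0<\varepsilon<1$ be real constants and let $\alpha=\frac{k}{\rho c}$. Suppose that $h_0>\frac{1}{D_\infty}\sqrt{\frac{\gamma(1-\varepsilon)\rho\ell k}{2}}$. Then Problem $(P_1)$ (with parameters $h_0,D_\infty$) is equivalent to Problem $(P_2)$ (with parameter $D_0$), in the sense that their solutions $(T,s,r)$ coincide, when $D_0$ is related to $h_0$ and $D_\infty$ by $$D_0=\frac{D_\infty\operatorname{erf}(\xi)}{\frac{k}{h_0\sqrt{\pi\alpha}}+\operatorname{erf}(\xi)}>0,$$ where the coefficient $\xi>0$ is the unique solution, for Problem $(P_1)$, of $$\frac{D_\infty c}{\ell\sqrt{\pi}}F(x)=G(x),\quad x>0,\qquad F(x)=\frac{e^{-x^2}}{\frac{k}{h_0\sqrt{\pi\alpha}}+\operatorname{erf}(x)},\quad G(x)=x+\frac{\gamma(1-\varepsilon)\sqrt{\pi}}{2D_\infty}\frac{1}{F(x)},$$ or, equally, the unique solution, for Problem $(P_2)$, of $$G_2(x)=\frac{D_0c}{\ell\sqrt{\pi}},\quad x>0,\qquad G_2(x)=\frac{1}{F_\infty(x)}\left[x+\frac{\gamma(1-\varepsilon)\sqrt{\pi}}{2D_0}\frac{1}{F_\infty(x)}\right],\quad F_\infty(x)=\frac{e^{-x^2}}{\operatorname{erf}(x)}.$$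
   Context: $\operatorname{erf}(x)=\frac{2}{\sqrt{\pi}}\int_0^x e^{-u^2}\,du$. Common conditions for a triple $(T,s,r)$ with $s(t)<r(t)$ for $t>0$: (i) $T_t-\alpha T_{xx}=0$ for $0<x<s(t)$, $t>0$; (ii) $T(s(t),t)=0$, $t>0$; (iii) $kT_x(s(t),t)=\rho\ell[\varepsilon\dot s(t)+(1-\varepsilon)\dot r(t)]$, $t>0$; (iv) $T_x(s(t),t)(r(t)-s(t))=\gamma$, $t>0$; (v) $s(0)=r(0)=0$. Problem $(P_1)$: (i)–(v) together with $kT_x(0,t)=\frac{h_0}{\sqrt t}(T(0,t)+D_\infty)$, $t>0$. Under the stated inequality on $h_0$ its solution is, with $\xi$ the unique positive root of $\frac{D_\infty c}{\ell\sqrt{\pi}}F=G$, $$T(x,t)=-\frac{\frac{h_0D_\infty\sqrt{\pi\alpha}}{k}\operatorname{erf}(\xi)}{1+\frac{h_0\sqrt{\pi\alpha}}{k}\operatorname{erf}(\xi)}\left[1-\frac{\operatorname{erf}\left(\frac{x}{2\sqrt{\alpha t}}\right)}{\operatorname{erf}(\xi)}\right],\quad s(t)=2\xi\sqrt{\alpha t},\quad r(t)=2\mu\sqrt{\alpha t},$$ $$\mu=\xi+\frac{\gamma k}{2D_\infty h_0\sqrt{\alpha}}e^{\xi^2}\left[1+\frac{h_0\sqrt{\pi\alpha}}{k}\operatorname{erf}(\xi)\right].$$ Problem $(P_2)$: (i)–(v) together with $T(0,t)=-D_0<0$, $t>0$. Its (known) solution is, with $\xi'$ the unique positive root of $G_2(x)=\frac{D_0c}{\ell\sqrt{\pi}}$,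 $$T(x,t)=-D_0\left[1-\frac{\operatorname{erf}\left(\frac{x}{2\sqrt{\alpha t}}\right)}{\operatorname{erf}(\xi')}\right],\quad s(t)=2\xi'\sqrt{\alpha t},\quad r(t)=2\mu'\sqrt{\alpha t},\quad \mu'=\xi'+\frac{\gamma\sqrt{\pi}}{2D_0}e^{\xi'^2}\operatorname{erf}(\xi').$$ In both cases $T$ is considered on $0<x<s(t)$, $t>0$. *)

(* Defs.v *)
From Stdlib Require Import Reals.
From Coquelicot Require Import Coquelicot.
Local Open Scope R_scope.

Definition erf (x : R) : R :=
  2 / sqrt PI * RInt (fun u => exp (- (u ^ 2))) 0 x.

Definition F (k alpha h0 x : R) : R :=
  exp (- (x ^ 2)) / (k / (h0 * sqrt (PI * alpha)) + erf x).

Definition G (k alpha gamma eps Dinf h0 x : R) : R :=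
  x + gamma * (1 - eps) * sqrt PI / (2 * Dinf) * (1 / F k alpha h0 x).

Definition Finf (x : R) : R := exp (- (x ^ 2)) / erf x.

Definition G2 (gamma eps D0 x : R) : R :=
  1 / Finf x * (x + gamma * (1 - eps) * sqrt PI / (2 * D0) * (1 / Finf x)).

Definition P1_equation (k c ell alpha gamma eps Dinf h0 x : R) : Prop :=
  Dinf * c / (ell * sqrt PI) * F k alpha h0 x = G k alpha gamma eps Dinf h0 x.

Definition P2_equation (c ell gamma eps D0 x : R) : Prop :=
  G2 gamma eps D0 x = D0 * c / (ell * sqrt PI).

Definition D0_of (k alpha Dinf h0 xi : R) : R :=
  Dinf * erf xi / (k / (h0 * sqrt (PI * alpha)) + erf xi).

(* A temperature is written [T x t]. Only its values on the open region
   0 < x < s(t), t > 0 are used, so boundary values of T and T_x are one-sided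
   limits in x from inside the region. *)
Definition T_x (T : R -> R -> R) (x t : R) : R := Derive (fun y => T y t) x.

(* [ex_derive_n _ 2] alone does not give the existence of the first
   derivative, hence the separate [mushy_ex_Tx]. The initial condition is
   read with continuity of s and r at 0: values at the single point t = 0
   would impose nothing on the free boundaries for t > 0. *)
Record mushy_conditions (k rho ell alpha gamma eps : R)
    (T : R -> R -> R) (s r : R -> R) : Prop := {
  mushy_order : forall t, 0 < t -> 0 < s t < r t;
  mushy_ex_Tt : forall x t, 0 < t -> 0 < x < s t -> ex_derive (T x) t;
  mushy_ex_Tx : forall x t, 0 < t -> 0 < x < s t ->
    ex_derive (fun y => T y t) x;
  mushy_ex_Txx : forall x t, 0 < t -> 0 < x < s t ->
    ex_derive_n (fun y => T y t) 2 x;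
  mushy_heat : forall x t, 0 < t -> 0 < x < s t ->
    Derive (T x) t - alpha * Derive_n (fun y => T y t) 2 x = 0;
  mushy_T_s : forall t, 0 < t ->
    filterlim (fun x => T x t) (at_left (s t)) (locally 0);
  mushy_ex_ds : forall t, 0 < t -> ex_derive s t;
  mushy_ex_dr : forall t, 0 < t -> ex_derive r t;
  mushy_flux_s : forall t, 0 < t -> exists q,
    filterlim (fun x => T_x T x t) (at_left (s t)) (locally q) /\
    k * q = rho * ell * (eps * Derive s t + (1 - eps) * Derive r t) /\
    q * (r t - s t) = gamma;
  mushy_s_0 : s 0 = 0 /\ filterlim s (at_right 0) (locally 0);
  mushy_r_0 : r 0 = 0 /\ filterlim r (at_right 0) (locally 0)
}.

Definition solves_P1 (k rho ell alpha gamma eps Dinf h0 : R)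
    (T : R -> R -> R) (s r : R -> R) : Prop :=
  mushy_conditions k rho ell alpha gamma eps T s r /\
  forall t, 0 < t -> exists T0 q0,
    filterlim (fun x => T x t) (at_right 0) (locally T0) /\
    filterlim (fun x => T_x T x t) (at_right 0) (locally q0) /\
    k * q0 = h0 / sqrt t * (T0 + Dinf).

Definition solves_P2 (k rho ell alpha gamma eps D0 : R)
    (T : R -> R -> R) (s r : R -> R) : Prop :=
  mushy_conditions k rho ell alpha gamma eps T s r /\
  forall t, 0 < t -> filterlim (fun x => T x t) (at_right 0) (locally (- D0)).

Definition front (alpha a t : R) : R := 2 * a * sqrt (alpha * t).

Definition T1 (k alpha Dinf h0 xi x t : R) : R :=
  - ((h0 * Dinf * sqrt (PI * alpha) / k * erf xi) /
     (1 + h0 * sqrt (PI * alpha) / k * erf xi)) *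
  (1 - erf (x / (2 * sqrt (alpha * t))) / erf xi).

Definition mu1 (k alpha gamma Dinf h0 xi : R) : R :=
  xi + gamma * k / (2 * Dinf * h0 * sqrt alpha) * exp (xi ^ 2) *
       (1 + h0 * sqrt (PI * alpha) / k * erf xi).

Definition T2 (alpha D0 xi x t : R) : R :=
  - D0 * (1 - erf (x / (2 * sqrt (alpha * t))) / erf xi).

Definition mu2 (gamma D0 xi : R) : R :=
  xi + gamma * sqrt PI / (2 * D0) * exp (xi ^ 2) * erf xi.

Definition coincide (T : R -> R -> R) (s r : R -> R)
    (T' : R -> R -> R) (s' r' : R -> R) : Prop :=
  (forall t, 0 <= t -> s t = s' t /\ r t = r' t) /\
  (forall x t, 0 < t -> 0 < x < s t -> T x t = T' x t).

(* The profile theta is arbitrary: no closed form is built into the class. *)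
Definition similarity (alpha : R) (T : R -> R -> R) (s r : R -> R) : Prop :=
  exists (theta : R -> R) (a b : R),
    (forall t, 0 <= t -> s t = front alpha a t /\ r t = front alpha b t) /\
    (forall x t, 0 < t -> 0 < x < s t ->
       T x t = theta (x / (2 * sqrt (alpha * t)))).

(* Main.v *)
Require Import Defs.
From Stdlib Require Import Reals Lra FunctionalExtensionality.
From Coquelicot Require Import Coquelicot.
Local Open Scope R_scope.

(** Along the similarity variable y = x / (2 sqrt (alpha t)) the heat equation is
    theta'' = - 2 y theta', so every similarity temperature is E + C erf y. On such
    a profile all the conditions become algebraic equations in a, b, E, C, where a
    and b are the front coefficients. The fixed-temperature problem forces
    E = - D0, C = D0 / erf a, b = mu2 and leaves G_2(a) = D0 c / (ell sqrt PI); the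
    Robin problem forces E = - D0_of a instead of E = - D0 and is otherwise the
    same. Multiplying the equation for the Robin front by
    erf x / (K + erf x), K = k / (h0 sqrt (PI alpha)), turns it into the equation
    for the fixed-temperature front with parameter D0_of x, so the two problems
    share their front coefficient and hence their solution. *)

(** * The error function *)

Lemma sqrt_PI_pos : 0 < sqrt PI.
Proof. apply sqrt_lt_R0, PI_RGT_0. Qed.

Lemma is_derive_erf (x : R) :
  is_derive erf x (2 / sqrt PI * exp (- (x ^ 2))).
Proof.
unfold erf.
apply (is_derive_scal (fun x => RInt (fun u => exp (- (u ^ 2))) 0 x) x).
assert (Hc : forall z, continuous (fun u => exp (- (u ^ 2))) z).
{ intros z. apply (ex_derive_continuous (fun u => exp (- (u ^ 2)))). auto_derive. exact I. }
apply (is_derive_RInt (fun u => exp (- (u ^ 2))) _ 0); [|apply Hc].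
apply filter_forall. intros y.
apply (RInt_correct (V := R_CompleteNormedModule)), ex_RInt_continuous.
intros z _. apply Hc.
Qed.

Lemma continuous_erf (x : R) : continuous erf x.
Proof.
apply (ex_derive_continuous erf). eexists. apply is_derive_erf.
Qed.

Lemma erf_0 : erf 0 = 0.
Proof. unfold erf. rewrite RInt_point. apply Rmult_0_r. Qed.

Lemma erf_incr (x y : R) : x < y -> erf x < erf y.
Proof.
intros Hxy.
apply (incr_function erf m_infty p_infty
  (fun x => 2 / sqrt PI * exp (- (x ^ 2)))); simpl; auto.
- intros z _ _. apply is_derive_erf.
- intros z _ _. apply Rmult_lt_0_compat; [|apply exp_pos].
  apply Rdiv_lt_0_compat; [lra|apply sqrt_PI_pos].
Qed.

Lemma erf_pos (x : R) : 0 < x -> 0 < erf x.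
Proof. intros Hx. rewrite <- erf_0. now apply erf_incr. Qed.

(** * One-sided neighbourhoods and limits *)

Lemma at_left_interval (a : R) : 0 < a -> at_left a (fun x => 0 < x < a).
Proof.
intros Ha. exists (mkposreal a Ha). intros y Hy Hlt.
unfold ball in Hy; simpl in Hy; unfold AbsRing_ball, abs, minus, plus, opp in Hy;
  simpl in Hy.
apply Rabs_def2 in Hy. lra.
Qed.

Lemma at_right_interval (a : R) : 0 < a -> at_right 0 (fun x => 0 < x < a).
Proof.
intros Ha. exists (mkposreal a Ha). intros y Hy Hlt.
unfold ball in Hy; simpl in Hy; unfold AbsRing_ball, abs, minus, plus, opp in Hy;
  simpl in Hy.
apply Rabs_def2 in Hy. lra.
Qed.

Lemma locally_interval (a b x : R) : a < x < b -> locally x (fun y => a < y < b).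
Proof.
intros [H1 H2]. apply filter_and; [now apply open_gt|now apply open_lt].
Qed.

Lemma filterlim_at_left_continuous (f : R -> R) (a : R) :
  continuous f a -> filterlim f (at_left a) (locally (f a)).
Proof.
intros Hf. apply filterlim_filter_le_1 with (2 := Hf).
intros P HP. now apply filter_le_within.
Qed.

Lemma filterlim_at_right_continuous (f : R -> R) (a : R) :
  continuous f a -> filterlim f (at_right a) (locally (f a)).
Proof.
intros Hf. apply filterlim_filter_le_1 with (2 := Hf).
intros P HP. now apply filter_le_within.
Qed.

Lemma constant_of_derive_0 (f : R -> R) (a : R) :
  (forall x, 0 < x < a -> is_derive f x 0) ->
  forall x y, 0 < x < a -> 0 < y < a -> f x = f y.
Proof.
intros Hf.
assert (Hlt : forall x y, 0 < x < a -> 0 < y < a -> x < y -> f x = f y).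
{ intros x y Hx Hy Hxy.
  apply (eq_is_derive f); [|exact Hxy].
  intros z Hz. apply Hf. lra. }
intros x y Hx Hy. destruct (Rtotal_order x y) as [H|[->|H]]; auto.
symmetry. auto.
Qed.

(** Temperatures are prescribed only inside the region and fronts only for nonnegative times, so
    limits at the boundary are obtained from formulas valid near the limit point. *)
Lemma filterlim_eq_near (U : (R -> Prop) -> Prop) (HU : Filter U) (f g : R -> R) (l : R) :
  U (fun x => f x = g x) -> filterlim g U (locally l) -> filterlim f U (locally l).
Proof.
intros H. apply filterlim_ext_loc. now apply (filter_imp _ _ (fun x Hx => eq_sym Hx)).
Qed.

(** * Error-function profiles and their conditions *)

(** Being a predicate on arbitrary [T], [s], [r], it applies both to an unknown similarity solution
    and to the closed forms, so one computation serves both directions. *)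
Definition erf_profile (alpha a b E C : R)
    (T : R -> R -> R) (s r : R -> R) : Prop :=
  (forall t, 0 <= t -> s t = front alpha a t /\ r t = front alpha b t) /\
  (forall x t, 0 < t -> 0 < x < s t ->
     T x t = E + C * erf (x / (2 * sqrt (alpha * t)))).

(* The conditions at the fronts for an [erf_profile]; the powers of t cancel. *)
Definition mushy_coefficients (k rho ell alpha gamma eps a b E C : R) : Prop :=
  a < b /\ E + C * erf a = 0 /\
  k * C * exp (- (a ^ 2)) / sqrt PI = rho * ell * alpha * (eps * a + (1 - eps) * b) /\
  2 * C * exp (- (a ^ 2)) / sqrt PI * (b - a) = gamma.

Section Profile.

Variable alpha : R.
Hypothesis Halpha : 0 < alpha.

Lemma front_scale_pos (t : R) : 0 < t -> 0 < 2 * sqrt (alpha * t).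
Proof.
intros Ht. apply Rmult_lt_0_compat; [lra|].
apply sqrt_lt_R0. now apply Rmult_lt_0_compat.
Qed.

Lemma front_scaleE (a t : R) : front alpha a t = a * (2 * sqrt (alpha * t)).
Proof. unfold front. ring. Qed.

Lemma front_pos_iff (a t : R) : 0 < t -> 0 < front alpha a t <-> 0 < a.
Proof.
intros Ht. rewrite front_scaleE. pose proof (front_scale_pos t Ht) as Hm.
split; intros H; [|nra].
apply Rmult_lt_reg_r with (1 := Hm). lra.
Qed.

(** The scale [2 * sqrt (alpha * t)] is kept as denominator because the temperature gradient has the
    same one, so time cancels between them. *)
Lemma is_derive_front (a t : R) : 0 < t ->
  is_derive (front alpha a) t (2 * a * alpha / (2 * sqrt (alpha * t))).
Proof.
intros Ht. pose proof (front_scale_pos t Ht) as Hm. unfold front.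
auto_derive.
- now apply Rmult_lt_0_compat.
- field. lra.
Qed.

Lemma filterlim_front_0 (a : R) :
  filterlim (front alpha a) (at_right 0) (locally 0).
Proof.
(* [sqrt] is 0 on negative arguments, so the front is continuous at 0 from both sides and its right
   limit is its value there. *)
replace 0 with (front alpha a 0) at 2
  by (unfold front; rewrite Rmult_0_r, sqrt_0; ring).
apply filterlim_at_right_continuous. unfold front.
apply (continuous_mult (fun _ : R => 2 * a) (fun t => sqrt (alpha * t))).
- apply continuous_const.
- apply (continuous_comp (fun t => alpha * t) sqrt).
  + apply (continuous_mult (fun _ => alpha) (fun t : R => t));
      [apply continuous_const|apply continuous_id].
  + apply continuous_sqrt.
Qed.

Variables (a b E C : R) (T : R -> R -> R) (s r : R -> R).
Hypothesis Ha : 0 < a.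
Hypothesis HP : erf_profile alpha a b E C T s r.

Lemma profile_fronts (t : R) : 0 <= t ->
  s t = a * (2 * sqrt (alpha * t)) /\ r t = b * (2 * sqrt (alpha * t)).
Proof. intros Ht. rewrite <- !front_scaleE. now apply (proj1 HP). Qed.

Lemma profile_s_pos (t : R) : 0 < t -> 0 < s t.
Proof.
intros Ht. destruct (proj1 HP t) as [-> _]; [lra|]. now apply front_pos_iff.
Qed.

Lemma profile_locally_x (x t : R) : 0 < t -> 0 < x < s t ->
  locally x (fun y => E + C * erf (y / (2 * sqrt (alpha * t))) = T y t).
Proof.
intros Ht Hx.
apply (filter_imp (fun y => 0 < y < s t)); [|now apply locally_interval].
intros y Hy. symmetry. now apply (proj2 HP).
Qed.

Lemma profile_locally_front (s' : R -> R) (t a' : R) : 0 < t ->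
  (forall t, 0 <= t -> s' t = front alpha a' t) ->
  locally t (fun t => front alpha a' t = s' t).
Proof.
intros Ht Hs. apply (filter_imp (fun u => 0 < u)); [|now apply open_gt].
intros u Hu. symmetry. apply Hs. lra.
Qed.

Lemma is_derive_profile_s (t : R) : 0 < t ->
  is_derive s t (2 * a * alpha / (2 * sqrt (alpha * t))).
Proof.
intros Ht. apply is_derive_ext_loc with (front alpha a).
- apply profile_locally_front; [easy|]. intros u Hu. now apply (proj1 HP).
- now apply is_derive_front.
Qed.

Lemma is_derive_profile_r (t : R) : 0 < t ->
  is_derive r t (2 * b * alpha / (2 * sqrt (alpha * t))).
Proof.
intros Ht. apply is_derive_ext_loc with (front alpha b).
- apply profile_locally_front; [easy|]. intros u Hu. now apply (proj1 HP).
- now apply is_derive_front.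
Qed.

Lemma is_derive_profile_x (x t : R) : 0 < t -> 0 < x < s t ->
  is_derive (fun y => T y t) x
    (C * (2 / sqrt PI * exp (- ((x / (2 * sqrt (alpha * t))) ^ 2)))
       / (2 * sqrt (alpha * t))).
Proof.
intros Ht Hx. pose proof (front_scale_pos t Ht) as Hm.
apply is_derive_ext_loc with (1 := profile_locally_x x t Ht Hx).
evar_last.
- apply (is_derive_plus (fun _ => E)); [apply is_derive_const|].
  apply (is_derive_scal (fun y => erf (y / (2 * sqrt (alpha * t))))).
  apply (is_derive_comp erf (fun y => y / (2 * sqrt (alpha * t)))).
  + apply is_derive_erf.
  + apply (is_derive_ext (fun y => / (2 * sqrt (alpha * t)) * y)).
    * intros y. apply Rmult_comm.
    * apply (is_derive_scal (fun y : R => y)), is_derive_id.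
- unfold plus, zero, scal, mult, one; simpl; unfold mult; simpl. field.
  pose proof sqrt_PI_pos. split; lra.
Qed.

Lemma profile_T_x (x t : R) : 0 < t -> 0 < x < s t ->
  T_x T x t = C * (2 / sqrt PI * exp (- ((x / (2 * sqrt (alpha * t))) ^ 2)))
       / (2 * sqrt (alpha * t)).
Proof. intros Ht Hx. now apply is_derive_unique, is_derive_profile_x. Qed.

Lemma is_derive_profile_xx (x t : R) : 0 < t -> 0 < x < s t ->
  is_derive (Derive (fun y => T y t)) x
    (- 2 * (x / (2 * sqrt (alpha * t))) *
       (C * (2 / sqrt PI * exp (- ((x / (2 * sqrt (alpha * t))) ^ 2))))
       / (2 * sqrt (alpha * t)) ^ 2).
Proof.
intros Ht Hx. pose proof (front_scale_pos t Ht) as Hm. pose proof sqrt_PI_pos as Hp.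
apply is_derive_ext_loc with
  (fun x => C * (2 / sqrt PI * exp (- ((x / (2 * sqrt (alpha * t))) ^ 2)))
       / (2 * sqrt (alpha * t))).
- apply (filter_imp (fun y => 0 < y < s t)); [|now apply locally_interval].
  intros y Hy. symmetry. now apply profile_T_x.
- auto_derive; [easy|]. unfold Rdiv. simpl pow.
  set (e := exp _). field. split; lra.
Qed.

Lemma is_derive_profile_t (x t : R) : 0 < t -> 0 < x < s t ->
  is_derive (T x) t
    (C * (2 / sqrt PI * exp (- ((x / (2 * sqrt (alpha * t))) ^ 2)))
      * (- 2 * alpha * x / (2 * sqrt (alpha * t)) ^ 3)).
Proof.
intros Ht Hx. pose proof (front_scale_pos t Ht) as Hm. pose proof sqrt_PI_pos as Hp.
apply is_derive_ext_loc with
  (fun t => E + C * erf (x / (2 * sqrt (alpha * t)))).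
(* The formula for [T x u] holds only while [x < s u]; continuity of the front keeps [x] inside the
   region for all times near [t]. *)
- assert (Hs : continuous s t)
    by (apply (ex_derive_continuous s); eexists; now apply is_derive_profile_s).
  assert (H1 : locally t (fun u => x < s u))
    by (apply (Hs (fun y => x < y)), open_gt; lra).
  generalize (filter_and _ _ H1 (open_gt 0 t Ht)). apply filter_imp.
  intros u [Hu Hu0]. symmetry. apply (proj2 HP); lra.
- evar_last.
  + apply (is_derive_plus (fun _ => E)); [apply is_derive_const|].
    apply (is_derive_scal (fun t => erf (x / (2 * sqrt (alpha * t))))).
    apply (is_derive_comp erf (fun t => x / (2 * sqrt (alpha * t)))).
    * apply is_derive_erf.
    * auto_derive; [|reflexivity]. repeat split; [nra|lra].
  + unfold plus, zero, scal; simpl; unfold mult; simpl. field. split; lra.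
Qed.

Lemma continuous_profile (t x : R) :
  continuous (fun x => E + C * erf (x / (2 * sqrt (alpha * t)))) x.
Proof.
apply (continuous_plus (fun _ => E)); [apply continuous_const|].
apply (continuous_mult (fun _ => C)); [apply continuous_const|].
apply (continuous_comp (fun x => x / (2 * sqrt (alpha * t))) erf).
- apply (continuous_mult (fun x : R => x) (fun _ => / (2 * sqrt (alpha * t))));
    [apply continuous_id|apply continuous_const].
- apply continuous_erf.
Qed.

Lemma continuous_profile_x (t x : R) :
  continuous (fun x => C * (2 / sqrt PI *
    exp (- ((x / (2 * sqrt (alpha * t))) ^ 2))) / (2 * sqrt (alpha * t))) x.
Proof.
apply ex_derive_continuous with (f := (fun x => C * (2 / sqrt PI *
    exp (- ((x / (2 * sqrt (alpha * t))) ^ 2))) / (2 * sqrt (alpha * t)))).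
auto_derive. exact I.
Qed.

Lemma profile_lim_left (t : R) : 0 < t ->
  filterlim (fun x => T x t) (at_left (s t)) (locally (E + C * erf a)).
Proof.
intros Ht. pose proof (front_scale_pos t Ht) as Hm.
eapply filterlim_eq_near; [apply within_filter, locally_filter| |].
- apply (filter_imp (fun x => 0 < x < s t)); [|now apply at_left_interval, profile_s_pos].
  intros x Hx. now apply (proj2 HP).
- replace (E + C * erf a) with (E + C * erf (s t / (2 * sqrt (alpha * t)))).
  + apply (filterlim_at_left_continuous
      (fun x => E + C * erf (x / (2 * sqrt (alpha * t))))), continuous_profile.
  + destruct (profile_fronts t) as [-> _]; [lra|]. do 3 f_equal. field. lra.
Qed.

Lemma profile_lim_right (t : R) : 0 < t ->
  filterlim (fun x => T x t) (at_right 0) (locally E).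
Proof.
intros Ht.
eapply filterlim_eq_near; [apply within_filter, locally_filter| |].
- apply (filter_imp (fun x => 0 < x < s t)); [|now apply at_right_interval, profile_s_pos].
  intros x Hx. now apply (proj2 HP).
- replace (locally E) with (locally (E + C * erf (0 / (2 * sqrt (alpha * t))))).
  + apply (filterlim_at_right_continuous
      (fun x => E + C * erf (x / (2 * sqrt (alpha * t)))) 0), continuous_profile.
  + unfold Rdiv. rewrite Rmult_0_l, erf_0. f_equal. ring.
Qed.

Lemma profile_T_x_lim_left (t : R) : 0 < t ->
  filterlim (fun x => T_x T x t) (at_left (s t))
    (locally (C * (2 / sqrt PI * exp (- (a ^ 2))) / (2 * sqrt (alpha * t)))).
Proof.
intros Ht. pose proof (front_scale_pos t Ht) as Hm.
eapply filterlim_eq_near; [apply within_filter, locally_filter| |].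
- apply (filter_imp (fun x => 0 < x < s t)); [|now apply at_left_interval, profile_s_pos].
  intros x Hx. now apply profile_T_x.
- replace a with (s t / (2 * sqrt (alpha * t))) at 1.
  + apply (filterlim_at_left_continuous _ _ (continuous_profile_x t (s t))).
  + destruct (profile_fronts t) as [-> _]; [lra|]. field. lra.
Qed.

Lemma profile_T_x_lim_right (t : R) : 0 < t ->
  filterlim (fun x => T_x T x t) (at_right 0)
    (locally (C * (2 / sqrt PI) / (2 * sqrt (alpha * t)))).
Proof.
intros Ht. pose proof (front_scale_pos t Ht) as Hm.
eapply filterlim_eq_near; [apply within_filter, locally_filter| |].
- apply (filter_imp (fun x => 0 < x < s t)); [|now apply at_right_interval, profile_s_pos].
  intros x Hx. now apply profile_T_x.
- replace (C * (2 / sqrt PI) / (2 * sqrt (alpha * t))) with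
    (C * (2 / sqrt PI * exp (- ((0 / (2 * sqrt (alpha * t))) ^ 2)))
       / (2 * sqrt (alpha * t))).
  + apply (filterlim_at_right_continuous _ _ (continuous_profile_x t 0)).
  + unfold Rdiv at 3. rewrite Rmult_0_l, pow_ne_zero, Ropp_0, exp_0 by easy.
    now rewrite Rmult_1_r.
Qed.

(** Each condition scales by a power of t. Hence evaluating at the single time 1, with uniqueness of
    limits, yields the coefficient equations, and these give the conditions back at every time. *)
Lemma mushy_profile_iff (k rho ell gamma eps : R) :
  mushy_conditions k rho ell alpha gamma eps T s r <->
  mushy_coefficients k rho ell alpha gamma eps a b E C.
Proof.
pose proof sqrt_PI_pos as Hp.
split.
- intros M. unfold mushy_coefficients.
  pose proof (front_scale_pos 1 Rlt_0_1) as Hm.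
  destruct (profile_fronts 1 Rle_0_1) as [Es Er].
  split; [|split].
  + pose proof (mushy_order _ _ _ _ _ _ _ _ _ M 1 Rlt_0_1) as Ho.
    apply Rmult_lt_reg_r with (1 := Hm). lra.
  + apply (filterlim_locally_unique (F := at_left (s 1)) (fun x => T x 1)).
    * apply profile_lim_left, Rlt_0_1.
    * apply (mushy_T_s _ _ _ _ _ _ _ _ _ M), Rlt_0_1.
  + destruct (mushy_flux_s _ _ _ _ _ _ _ _ _ M 1 Rlt_0_1) as (q & Hq & H1 & H2).
    assert (Eq : q = C * (2 / sqrt PI * exp (- (a ^ 2))) / (2 * sqrt (alpha * 1))).
    { apply (filterlim_locally_unique (F := at_left (s 1)) (fun x => T_x T x 1)); auto.
      apply profile_T_x_lim_left, Rlt_0_1. }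
    rewrite (is_derive_unique _ _ _ (is_derive_profile_s 1 Rlt_0_1)),
      (is_derive_unique _ _ _ (is_derive_profile_r 1 Rlt_0_1)) in H1.
    rewrite Es, Er in H2. rewrite Eq in H1, H2.
    split.
    (* Gradient and front speeds at time 1 both carry this factor; multiplying by it turns the
       coefficient equation into the flux condition. *)
    * apply Rmult_eq_reg_r with (2 / (2 * sqrt (alpha * 1))).
      -- etransitivity; [etransitivity; [|exact H1]|]; field; lra.
      -- apply Rgt_not_eq, Rdiv_lt_0_compat; lra.
    * rewrite <- H2. field. lra.
- intros (Hab & HT & Hflux & Hgap).
  split.
  + intros t Ht. pose proof (front_scale_pos t Ht) as Hm.
    destruct (profile_fronts t) as [-> ->]; [lra|]. split; nra.
  + intros x t Ht Hx. eexists. now apply is_derive_profile_t.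
  + intros x t Ht Hx. eexists. now apply is_derive_profile_x.
  + intros x t Ht Hx. eexists. now apply is_derive_profile_xx.
  + intros x t Ht Hx. pose proof (front_scale_pos t Ht) as Hm.
    rewrite (is_derive_unique _ _ _ (is_derive_profile_t x t Ht Hx)).
    simpl Derive_n.
    change (Derive (fun x => Derive (fun y => T y t) x) x)
      with (Derive (Derive (fun y => T y t)) x).
    rewrite (is_derive_unique _ _ _ (is_derive_profile_xx x t Ht Hx)).
    (* With m = 2 sqrt (alpha t), both [T_t] and [alpha * T_xx] equal -2 alpha x / m^3 times the
       same exponential factor. *)
    set (e := exp _). field. lra.
  + intros t Ht. rewrite <- HT. now apply profile_lim_left.
  + intros t Ht. eexists. now apply is_derive_profile_s.
  + intros t Ht. eexists. now apply is_derive_profile_r.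
  + intros t Ht. pose proof (front_scale_pos t Ht) as Hm.
    exists (C * (2 / sqrt PI * exp (- (a ^ 2))) / (2 * sqrt (alpha * t))).
    split; [now apply profile_T_x_lim_left|].
    rewrite (is_derive_unique _ _ _ (is_derive_profile_s t Ht)),
      (is_derive_unique _ _ _ (is_derive_profile_r t Ht)).
    destruct (profile_fronts t) as [-> ->]; [lra|].
    split.
    * transitivity (k * C * exp (- (a ^ 2)) / sqrt PI * (2 / (2 * sqrt (alpha * t)))).
      -- field. lra.
      -- rewrite Hflux. field. lra.
    * rewrite <- Hgap. field. lra.
  + split.
    * destruct (profile_fronts 0) as [-> _]; [lra|]. rewrite Rmult_0_r, sqrt_0. ring.
    * apply filterlim_eq_near with (front alpha a);
        [apply within_filter, locally_filter| |apply filterlim_front_0].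
      apply (filter_imp (fun t => 0 < t < 1)); [|apply at_right_interval; lra].
      intros t Ht. apply (proj1 HP). lra.
  + split.
    * destruct (profile_fronts 0) as [_ ->]; [lra|]. rewrite Rmult_0_r, sqrt_0. ring.
    * apply filterlim_eq_near with (front alpha b);
        [apply within_filter, locally_filter| |apply filterlim_front_0].
      apply (filter_imp (fun t => 0 < t < 1)); [|apply at_right_interval; lra].
      intros t Ht. apply (proj1 HP). lra.
Qed.

(** As erf vanishes at 0, [E] is the temperature at the face x = 0 at all times. *)
Lemma solves_P2_profile_iff (k rho ell gamma eps D0 : R) :
  solves_P2 k rho ell alpha gamma eps D0 T s r <->
  mushy_coefficients k rho ell alpha gamma eps a b E C /\ E = - D0.
Proof.
unfold solves_P2. rewrite mushy_profile_iff.
split; intros [HM HB]; (split; [exact HM|]).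
- apply (filterlim_locally_unique (F := at_right 0) (fun x => T x 1)).
  + apply profile_lim_right, Rlt_0_1.
  + apply HB, Rlt_0_1.
- intros t Ht. rewrite <- HB. now apply profile_lim_right.
Qed.

(** The gradient at the face x = 0 decays like 1 / sqrt t, exactly as the Robin coefficient
    [h0 / sqrt t], so the Robin condition is one equation free of t. *)
Lemma solves_P1_profile_iff (k rho ell gamma eps Dinf h0 : R) :
  solves_P1 k rho ell alpha gamma eps Dinf h0 T s r <->
  mushy_coefficients k rho ell alpha gamma eps a b E C /\
  k * C / sqrt PI = h0 * sqrt alpha * (E + Dinf).
Proof.
unfold solves_P1. rewrite mushy_profile_iff.
pose proof sqrt_PI_pos as Hp. pose proof (sqrt_lt_R0 _ Halpha) as Hsa.
split; intros [HM HB]; (split; [exact HM|]).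
- destruct (HB 1 Rlt_0_1) as (T0 & q0 & HT & Hq & H1).
  assert (ET : T0 = E).
  { apply (filterlim_locally_unique (F := at_right 0) (fun x => T x 1)); auto.
    apply profile_lim_right, Rlt_0_1. }
  assert (Eq : q0 = C * (2 / sqrt PI) / (2 * sqrt (alpha * 1))).
  { apply (filterlim_locally_unique (F := at_right 0) (fun x => T_x T x 1)); auto.
    apply profile_T_x_lim_right, Rlt_0_1. }
  rewrite ET, Eq, Rmult_1_r, sqrt_1 in H1.
  apply Rmult_eq_reg_r with (/ sqrt alpha).
  + etransitivity; [etransitivity; [|exact H1]|]; field; lra.
  + now apply Rgt_not_eq, Rinv_0_lt_compat.
- intros t Ht. pose proof (sqrt_lt_R0 _ Ht) as Hst.
  exists E, (C * (2 / sqrt PI) / (2 * sqrt (alpha * t))).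
  split; [now apply profile_lim_right|split; [now apply profile_T_x_lim_right|]].
  rewrite sqrt_mult by lra.
  transitivity (k * C / sqrt PI / (sqrt alpha * sqrt t)).
  + field. lra.
  + rewrite HB. field. lra.
Qed.

End Profile.

(** * Similarity solutions are error-function profiles *)

(* At the time 1 / (4 alpha) the similarity variable equals x, so the profile is
   the temperature itself at that time; the heat equation becomes
   theta'' = - 2 y theta', i.e. theta' exp (y^2) is constant. *)
Lemma similarity_profile (k rho ell alpha gamma eps : R)
    (T : R -> R -> R) (s r : R -> R) :
  0 < alpha -> similarity alpha T s r ->
  mushy_conditions k rho ell alpha gamma eps T s r ->
  exists a b E C, 0 < a /\ erf_profile alpha a b E C T s r.
Proof.
intros Halpha (theta & a & b & Hsr & HT) M.
assert (Ha : 0 < a).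
{ apply (front_pos_iff alpha Halpha a 1 Rlt_0_1).
  rewrite <- (proj1 (Hsr 1 Rle_0_1)).
  apply (mushy_order _ _ _ _ _ _ _ _ _ M 1 Rlt_0_1). }
set (t0 := / (4 * alpha)).
assert (Ht0 : 0 < t0) by (apply Rinv_0_lt_compat; lra).
assert (Hs0 : 2 * sqrt (alpha * t0) = 1).
{ replace (alpha * t0) with ((/ 2) ^ 2) by (unfold t0; field; lra).
  rewrite sqrt_pow2; lra. }
assert (Es : s t0 = a).
{ rewrite (proj1 (Hsr t0 (Rlt_le _ _ Ht0))), front_scaleE, Hs0. ring. }
assert (HT0 : forall y, 0 < y < a -> T y t0 = theta y).
{ intros y Hy. rewrite HT, Hs0, Rdiv_1_r; auto. now rewrite Es. }
(* No regularity is assumed of [theta]; [phi] agrees with it on (0, a) and inherits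
   differentiability from the conditions on [T]. *)
set (phi := fun y => T y t0).
assert (D1 : forall y, 0 < y < a -> is_derive phi y (Derive phi y)).
{ intros y Hy. apply Derive_correct, (mushy_ex_Tx _ _ _ _ _ _ _ _ _ M); auto.
  now rewrite Es. }
(* Near [t0], similarity gives T(y, t) = phi(y / (2 sqrt (alpha t))), and the inner function has
   time derivative -2 alpha y at [t0]. *)
assert (Dt : forall y, 0 < y < a ->
  is_derive (T y) t0 (Derive phi y * (- 2 * alpha * y))).
{ intros y Hy.
  apply is_derive_ext_loc with (fun t => phi (y / (2 * sqrt (alpha * t)))).
  - assert (Hc : continuous s t0).
    { apply (ex_derive_continuous s), (mushy_ex_ds _ _ _ _ _ _ _ _ _ M t0 Ht0). }
    assert (H1 : locally t0 (fun u => y < s u))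
      by (apply (Hc (fun z => y < z)), open_gt; lra).
    generalize (filter_and _ _ H1 (open_gt 0 t0 Ht0)). apply filter_imp.
    intros u [Hu Hu0]. pose proof (front_scale_pos alpha Halpha u Hu0) as Hm.
    rewrite (proj1 (Hsr u (Rlt_le _ _ Hu0))), front_scaleE in Hu.
    unfold phi. rewrite HT0.
    + symmetry. apply HT; auto.
      rewrite (proj1 (Hsr u (Rlt_le _ _ Hu0))), front_scaleE. lra.
    + split; [apply Rdiv_lt_0_compat; lra|].
      apply Rmult_lt_reg_r with (1 := Hm).
      replace (y / (2 * sqrt (alpha * u)) * (2 * sqrt (alpha * u))) with y; [lra|].
      field. lra.
  - evar_last.
    + apply (is_derive_comp phi (fun t => y / (2 * sqrt (alpha * t)))).
      * rewrite Hs0, Rdiv_1_r. now apply D1.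
      * auto_derive; [|reflexivity].
        split; [nra|]. split; [rewrite Hs0; lra|easy].
    + unfold scal; simpl; unfold mult; simpl.
      replace (sqrt (alpha * t0)) with (/ 2) by lra. field. }
assert (D2 : forall y, 0 < y < a ->
  is_derive (Derive phi) y (- 2 * y * Derive phi y)).
{ intros y Hy. rewrite <- Es in Hy.
  pose proof (mushy_ex_Txx _ _ _ _ _ _ _ _ _ M y t0 Ht0 Hy) as Hex.
  pose proof (mushy_heat _ _ _ _ _ _ _ _ _ M y t0 Ht0 Hy) as Hh.
  change (ex_derive (Derive phi) y) in Hex.
  change (Derive (T y) t0 - alpha * Derive (Derive phi) y = 0) in Hh.
  rewrite Es in Hy. rewrite (is_derive_unique _ _ _ (Dt y Hy)) in Hh.
  replace (- 2 * y * Derive phi y) with (Derive (Derive phi) y);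
    [now apply Derive_correct|].
  apply Rmult_eq_reg_l with alpha; lra. }
(* The constant value of phi' exp (y^2) is read off at the interior point a / 2; sqrt PI / 2
   compensates the factor in the derivative of erf. [E] then matches [phi] at the same point. *)
set (C := Derive phi (a / 2) * exp ((a / 2) ^ 2) * (sqrt PI / 2)).
set (E := phi (a / 2) - C * erf (a / 2)).
pose proof sqrt_PI_pos as Hp.
assert (Hhalf : 0 < a / 2 < a) by lra.
assert (Hphi' : forall y, 0 < y < a ->
  Derive phi y = C * (2 / sqrt PI * exp (- (y ^ 2)))).
{ intros y Hy.
  assert (Hc : Derive phi y * exp (y ^ 2) = Derive phi (a / 2) * exp ((a / 2) ^ 2)).
  { apply (constant_of_derive_0 (fun y => Derive phi y * exp (y ^ 2)) a); auto.
    intros z Hz. evar_last.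
    - apply (is_derive_mult (Derive phi) (fun y => exp (y ^ 2)));
        [now apply D2| |intros; apply Rmult_comm].
      auto_derive; [easy|reflexivity].
    - unfold plus, mult; simpl. ring. }
  unfold C. rewrite <- Hc.
  replace (Derive phi y) with (Derive phi y * (exp (y ^ 2) * exp (- (y ^ 2)))) at 1.
  - field. lra.
  - rewrite <- exp_plus, Rplus_opp_r, exp_0. ring. }
assert (Hphi : forall y, 0 < y < a -> phi y = E + C * erf y).
{ intros y Hy. unfold E.
  enough (phi y - C * erf y = phi (a / 2) - C * erf (a / 2)) by lra.
  apply (constant_of_derive_0 (fun y => phi y - C * erf y) a); auto.
  intros z Hz. evar_last.
  - apply (is_derive_minus phi (fun y => C * erf y)); [now apply D1|].
    apply (is_derive_scal erf), is_derive_erf.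
  - rewrite Hphi' by easy. unfold minus, plus, opp; simpl. ring. }
exists a, b, E, C. split; [exact Ha|split; [exact Hsr|]].
intros x t Ht Hx. pose proof (front_scale_pos alpha Halpha t Ht) as Hm.
assert (Hx' := Hx).
rewrite (proj1 (Hsr t (Rlt_le _ _ Ht))), front_scaleE in Hx'.
assert (Hy : 0 < x / (2 * sqrt (alpha * t)) < a).
{ split; [apply Rdiv_lt_0_compat; lra|].
  apply Rmult_lt_reg_r with (1 := Hm).
  replace (x / (2 * sqrt (alpha * t)) * (2 * sqrt (alpha * t))) with x; [lra|].
  field. lra. }
(* The similarity variable carries any point of the region to time [t0], where the temperature is
   [phi]. *)
rewrite HT, <- HT0 by easy. now apply Hphi.
Qed.

(** * The two front equations *)

(* Both front equations read [front_lhs K B x = A]: the Robin problem has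
   K = k / (h0 sqrt (PI alpha)), the fixed-temperature problem has K = 0. *)
Definition front_lhs (K B x : R) : R :=
  (K + erf x) * exp (x ^ 2) * (x + B * ((K + erf x) * exp (x ^ 2))).

Lemma ex_derive_front_lhs (K B x : R) : ex_derive (front_lhs K B) x.
Proof.
unfold front_lhs. auto_derive.
assert (ex_derive erf x) by (eexists; apply is_derive_erf). tauto.
Qed.

(** With g = (K + erf x) exp (x^2), nonnegative and strictly increasing, the function is g (x + B
    g). The factors are increased one at a time; strictness comes from the second, since g is
    positive at the larger point. *)
Lemma front_lhs_incr (K B x y : R) :
  0 <= K -> 0 <= B -> 0 <= x < y -> front_lhs K B x < front_lhs K B y.
Proof.
intros HK HB [Hx Hxy]. unfold front_lhs.
assert (Hex : 0 <= erf x).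
{ destruct Hx as [Hx| <-]; [left; now apply erf_pos|rewrite erf_0; lra]. }
pose proof (erf_incr x y Hxy) as Hexy.
assert (Hg : (K + erf x) * exp (x ^ 2) < (K + erf y) * exp (y ^ 2)).
{ apply Rmult_ge_0_gt_0_lt_compat; try lra.
  - apply Rle_ge, Rlt_le, exp_pos.
  - apply exp_increasing. nra. }
assert (Hg0 : 0 <= (K + erf x) * exp (x ^ 2))
  by (apply Rmult_le_pos; [lra|left; apply exp_pos]).
set (gx := _ * exp (x ^ 2)) in *. set (gy := _ * exp (y ^ 2)) in *. clearbody gx gy.
apply Rle_lt_trans with (gy * (x + B * gx)).
- apply Rmult_le_compat_r; nra.
- apply Rmult_lt_compat_l; nra.
Qed.

Lemma front_lhs_inj (K B x y : R) : 0 <= K -> 0 <= B -> 0 < x -> 0 < y ->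
  front_lhs K B x = front_lhs K B y -> x = y.
Proof.
intros HK HB Hx Hy Heq.
destruct (Rtotal_order x y) as [H|[H|H]]; [|exact H|].
- pose proof (front_lhs_incr K B x y HK HB). lra.
- pose proof (front_lhs_incr K B y x HK HB). lra.
Qed.

(** The value at 0 is K^2 B because erf 0 = 0. At A / K the first factor exceeds K and the second is
    at least A / K, so the value exceeds A, and the intermediate value theorem applies. *)
Lemma front_lhs_root (K B A : R) : 0 < K -> 0 <= B -> K ^ 2 * B < A ->
  exists x, 0 < x /\ front_lhs K B x = A.
Proof.
intros HK HB HA.
assert (HA0 : 0 < A) by (pose proof (pow2_ge_0 K); nra).
assert (H0 : front_lhs K B 0 < A).
{ unfold front_lhs. rewrite erf_0, pow_ne_zero, exp_0 by easy. lra. }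
assert (Hz : 0 < A / K) by now apply Rdiv_lt_0_compat.
assert (H1 : A < front_lhs K B (A / K)).
{ unfold front_lhs. pose proof (erf_pos _ Hz) as He.
  assert (Hexp : 1 < exp ((A / K) ^ 2)).
  { rewrite <- exp_0. apply exp_increasing. nra. }
  assert (Hg : K < (K + erf (A / K)) * exp ((A / K) ^ 2)) by nra.
  set (g := _ * exp _) in *. clearbody g.
  assert (HAK : A = K * (A / K)) by (field; lra).
  set (z := A / K) in *. clearbody z.
  rewrite HAK. apply Rlt_le_trans with (g * z).
  - now apply Rmult_lt_compat_r.
  - apply Rmult_le_compat_l; nra. }
destruct (IVT_gen (front_lhs K B) 0 (A / K) A) as (x & Hx & Hfx).
- intros x. apply continuity_pt_filterlim.
  apply (ex_derive_continuous (front_lhs K B)), ex_derive_front_lhs.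
- rewrite Rmin_left, Rmax_right; lra.
- exists x. split; [|exact Hfx].
  rewrite Rmin_left in Hx by lra.
  destruct Hx as [[Hx|Hx] _]; [exact Hx|]. rewrite <- Hx in Hfx. lra.
Qed.

Definition robin_offset (k alpha h0 : R) : R := k / (h0 * sqrt (PI * alpha)).

Lemma robin_offset_pos (k alpha h0 : R) :
  0 < k -> 0 < alpha -> 0 < h0 -> 0 < robin_offset k alpha h0.
Proof.
intros Hk Ha Hh. apply Rdiv_lt_0_compat; [exact Hk|].
apply Rmult_lt_0_compat; [exact Hh|].
apply sqrt_lt_R0, Rmult_lt_0_compat; [apply PI_RGT_0|exact Ha].
Qed.

(** With g = (K + erf x) exp (x^2) one has F = 1 / g, so the equation reads A / g = x + B g and is
    multiplied by g. *)
Lemma P1_equationE (k c ell alpha gamma eps Dinf h0 x : R) :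
  0 < k -> 0 < alpha -> 0 < h0 -> 0 < x ->
  P1_equation k c ell alpha gamma eps Dinf h0 x <->
  front_lhs (robin_offset k alpha h0) (gamma * (1 - eps) * sqrt PI / (2 * Dinf)) x
    = Dinf * c / (ell * sqrt PI).
Proof.
intros Hk Ha Hh Hx. unfold P1_equation, G, F, front_lhs.
fold (robin_offset k alpha h0).
pose proof (robin_offset_pos k alpha h0 Hk Ha Hh) as HK.
pose proof (erf_pos x Hx) as He. pose proof (exp_pos (x ^ 2)) as Hexp.
rewrite exp_Ropp.
set (K := robin_offset k alpha h0) in *. set (B := _ / (2 * Dinf)).
set (A := _ / (ell * sqrt PI)).
set (w := exp (x ^ 2)) in *. set (y := erf x) in *. clearbody K B A w y.
replace (1 / (/ w / (K + y))) with ((K + y) * w) by (field; lra).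
assert (HW : 0 < (K + y) * w) by nra.
replace (A * (/ w / (K + y))) with (A / ((K + y) * w)) by (field; lra).
split; intros H.
- rewrite <- H. field. lra.
- rewrite <- H. field. lra.
Qed.

Lemma P2_equationE (c ell gamma eps D0 x : R) : 0 < x ->
  P2_equation c ell gamma eps D0 x <->
  front_lhs 0 (gamma * (1 - eps) * sqrt PI / (2 * D0)) x = D0 * c / (ell * sqrt PI).
Proof.
intros Hx. unfold P2_equation, G2, Finf, front_lhs.
rewrite exp_Ropp, Rplus_0_l.
pose proof (erf_pos x Hx) as He. pose proof (exp_pos (x ^ 2)) as Hexp.
replace (1 / (/ exp (x ^ 2) / erf x)) with (erf x * exp (x ^ 2)) by (field; lra).
tauto.
Qed.

Lemma D0_of_pos (k alpha Dinf h0 x : R) :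
  0 < k -> 0 < alpha -> 0 < h0 -> 0 < Dinf -> 0 < x -> 0 < D0_of k alpha Dinf h0 x.
Proof.
intros Hk Ha Hh HD Hx.
pose proof (robin_offset_pos k alpha h0 Hk Ha Hh) as HK. unfold robin_offset in HK.
pose proof (erf_pos x Hx) as He.
apply Rdiv_lt_0_compat; nra.
Qed.

(** With y = erf x, passing from [Dinf] to [D0_of x] scales the right side by y / (K + y) and the
    coefficient B by (K + y) / y. The latter exactly turns B (K + y) into the fixed-temperature
    term. *)
Lemma P1_P2_equation_iff (k c ell alpha gamma eps Dinf h0 x : R) :
  0 < k -> 0 < ell -> 0 < alpha -> 0 < h0 -> 0 < Dinf -> 0 < x ->
  P1_equation k c ell alpha gamma eps Dinf h0 x <->
  P2_equation c ell gamma eps (D0_of k alpha Dinf h0 x) x.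
Proof.
intros Hk Hell Ha Hh HD Hx.
rewrite P1_equationE, P2_equationE by easy.
pose proof (robin_offset_pos k alpha h0 Hk Ha Hh) as HK.
pose proof (erf_pos x Hx) as He. pose proof sqrt_PI_pos as Hp.
unfold D0_of. fold (robin_offset k alpha h0).
set (K := robin_offset k alpha h0) in *. clearbody K. unfold front_lhs.
set (w := exp (x ^ 2)). set (y := erf x) in *. clearbody w y.
assert (Hth : 0 < y / (K + y)) by (apply Rdiv_lt_0_compat; lra).
split; intros H.
- transitivity (Dinf * c / (ell * sqrt PI) * (y / (K + y))).
  + rewrite <- H. field. lra.
  + field. lra.
- apply Rmult_eq_reg_r with (y / (K + y)); [|lra].
  etransitivity; [etransitivity; [|exact H]|]; field; lra.
Qed.

(** * From coefficients to the front equation *)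

(** The zero temperature at the front determines [C], the gap condition then determines [b], and the
    flux condition becomes the front equation. Conversely a < b because the gap is a product of
    positive terms. *)
Lemma mushy_coefficients_iff (k rho c ell alpha gamma eps a b E C D0 : R) :
  0 < k -> 0 < rho -> 0 < c -> 0 < ell -> 0 < gamma -> alpha = k / (rho * c) ->
  0 < a -> 0 < D0 -> E = - D0 ->
  mushy_coefficients k rho ell alpha gamma eps a b E C <->
  P2_equation c ell gamma eps D0 a /\ b = mu2 gamma D0 a /\ C = D0 / erf a.
Proof.
intros Hk Hrho Hc Hell Hgamma Halpha Ha HD0 HE.
rewrite P2_equationE by easy. unfold mushy_coefficients, mu2, front_lhs.
pose proof (erf_pos a Ha) as He. pose proof sqrt_PI_pos as Hp.
pose proof (exp_pos (a ^ 2)) as Hw.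
rewrite exp_Ropp, Rplus_0_l, HE, Halpha.
set (w := exp (a ^ 2)) in *. set (y := erf a) in *. set (p := sqrt PI) in *.
clearbody w y p. clear HE Halpha E alpha.
split.
- intros (Hab & HC & Hflux & Hgap).
  assert (EC : C = D0 / y).
  { apply Rmult_eq_reg_r with y; [|lra].
    replace (D0 / y * y) with D0 by (field; lra). lra. }
  assert (Eb : b = a + gamma * p / (2 * D0) * w * y).
  { rewrite <- Hgap, EC. field. lra. }
  split; [|now split].
  rewrite EC in Hflux.
  replace (eps * a + (1 - eps) * b) with (a + (1 - eps) * (b - a)) in Hflux by ring.
  replace (b - a) with (gamma * p / (2 * D0) * w * y) in Hflux by lra.
  (* This factor cancels [y * w] in [front_lhs] and turns the right side into k C exp (-a^2) / sqrt
     PI; rho alpha = k / c accounts for the rest. *)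
  apply Rmult_eq_reg_r with (k * ell / (c * (y * w))).
  + etransitivity; [etransitivity; [|symmetry; exact Hflux]|]; field; lra.
  + apply Rgt_not_eq, Rdiv_lt_0_compat; repeat apply Rmult_lt_0_compat; lra.
- intros (HH & Eb & EC).
  assert (Hba : b - a = gamma * p / (2 * D0) * w * y) by lra.
  split; [|split; [|split]].
  + enough (0 < gamma * p / (2 * D0) * w * y) by lra.
    unfold Rdiv. repeat apply Rmult_lt_0_compat; try lra.
    apply Rinv_0_lt_compat. lra.
  + rewrite EC. field. lra.
  + replace (eps * a + (1 - eps) * b) with (a + (1 - eps) * (b - a)) by ring.
    rewrite Hba, EC.
    transitivity (D0 * c / (ell * p) * (k * ell / (c * (y * w)))); [field; lra|].
    rewrite <- HH. field. lra.
  + rewrite Hba, EC. field. lra.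
Qed.

(** Substituting E = - C erf a makes the Robin condition linear in [C]: C (k + h0 sqrt (PI alpha)
    erf a) = h0 sqrt (PI alpha) Dinf. *)
Lemma robin_condition_iff (k alpha Dinf h0 a E C : R) :
  0 < k -> 0 < alpha -> 0 < h0 -> 0 < a -> E + C * erf a = 0 ->
  k * C / sqrt PI = h0 * sqrt alpha * (E + Dinf) <-> E = - D0_of k alpha Dinf h0 a.
Proof.
intros Hk Halpha Hh Ha HE.
pose proof (erf_pos a Ha) as He. pose proof sqrt_PI_pos as Hp.
pose proof (sqrt_lt_R0 _ Halpha) as Hsa.
unfold D0_of. rewrite sqrt_mult by (pose proof PI_RGT_0; lra).
assert (EE : E = - C * erf a) by lra.
set (y := erf a) in *. set (p := sqrt PI) in *. set (q := sqrt alpha) in *.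
clearbody y p q. subst E.
assert (Hpq : 0 < h0 * (p * q)) by (repeat apply Rmult_lt_0_compat; lra).
assert (Hy : 0 < h0 * (p * q) * y) by now apply Rmult_lt_0_compat.
split; intros H.
- assert (HC : C * (k + h0 * (p * q) * y) = h0 * (p * q) * Dinf).
  { transitivity (p * (k * C / p) + C * (h0 * (p * q) * y)); [field; lra|].
    rewrite H. ring. }
  replace C with (h0 * (p * q) * Dinf / (k + h0 * (p * q) * y)).
  + field. repeat split; lra.
  + rewrite <- HC. field. lra.
- assert (HC : C = Dinf / (k / (h0 * (p * q)) + y)).
  { apply Rmult_eq_reg_r with (- y); [|lra].
    transitivity (- C * y); [ring|]. rewrite H. unfold Rdiv. ring. }
  rewrite HC. field. repeat split; lra.
Qed.

Lemma coincide_T2_iff (alpha a b D0 : R) (T : R -> R -> R) (s r : R -> R) :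
  coincide T s r (T2 alpha D0 a) (front alpha a) (front alpha b) <->
  erf_profile alpha a b (- D0) (D0 / erf a) T s r.
Proof.
unfold coincide, erf_profile, T2.
split; intros [Hsr HT]; (split; [exact Hsr|]); intros x t Ht Hx;
  rewrite HT by easy; unfold Rdiv; ring.
Qed.

(** * Classification of the similarity solutions *)

(** The front coefficient of any solution is a positive root of the front equation, so uniqueness of
    the root pins it to [xi], and the remaining coefficients follow. *)
Lemma similarity_solves_P2_iff (k rho c ell alpha gamma eps D0 xi : R)
    (T : R -> R -> R) (s r : R -> R) :
  0 < k -> 0 < rho -> 0 < c -> 0 < ell -> 0 < gamma -> alpha = k / (rho * c) ->
  0 < D0 ->
  unique (fun x => 0 < x /\ P2_equation c ell gamma eps D0 x) xi ->
  similarity alpha T s r ->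
  solves_P2 k rho ell alpha gamma eps D0 T s r <->
  coincide T s r (T2 alpha D0 xi) (front alpha xi) (front alpha (mu2 gamma D0 xi)).
Proof.
intros Hk Hrho Hc Hell Hgamma Halpha HD0 [[Hxi Heq] Huniq] Hsim.
assert (Hal : 0 < alpha)
  by (rewrite Halpha; apply Rdiv_lt_0_compat; [lra|now apply Rmult_lt_0_compat]).
rewrite coincide_T2_iff. split.
- intros HS. destruct (similarity_profile _ _ _ _ _ _ _ _ _ Hal Hsim (proj1 HS))
    as (a & b & E & C & Ha & HP).
  apply (solves_P2_profile_iff alpha Hal a b E C T s r Ha HP) in HS.
  destruct HS as [HM HE].
  apply (mushy_coefficients_iff k rho c ell alpha gamma eps a b E C D0) in HM; auto.
  destruct HM as (Ha2 & Hb & HC).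
  rewrite (Huniq a (conj Ha Ha2)). now rewrite <- HC, <- Hb, <- HE.
- intros HP.
  apply (solves_P2_profile_iff alpha Hal _ _ _ _ T s r Hxi HP).
  split; [|reflexivity].
  now apply (mushy_coefficients_iff k rho c ell alpha gamma eps) with D0.
Qed.

(** The answer is expressed through [T2] and [mu2], so that it is literally the characterisation of
    the fixed-temperature problem. *)
Lemma similarity_solves_P1_iff (k rho c ell alpha gamma eps Dinf h0 xi : R)
    (T : R -> R -> R) (s r : R -> R) :
  0 < k -> 0 < rho -> 0 < c -> 0 < ell -> 0 < gamma -> alpha = k / (rho * c) ->
  0 < Dinf -> 0 < h0 ->
  unique (fun x => 0 < x /\ P1_equation k c ell alpha gamma eps Dinf h0 x) xi ->
  similarity alpha T s r ->
  let D0 := D0_of k alpha Dinf h0 xi in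
  solves_P1 k rho ell alpha gamma eps Dinf h0 T s r <->
  coincide T s r (T2 alpha D0 xi) (front alpha xi) (front alpha (mu2 gamma D0 xi)).
Proof.
intros Hk Hrho Hc Hell Hgamma Halpha HD Hh [[Hxi Heq] Huniq] Hsim D0.
assert (Hal : 0 < alpha)
  by (rewrite Halpha; apply Rdiv_lt_0_compat; [lra|now apply Rmult_lt_0_compat]).
assert (HD0 : forall x, 0 < x -> 0 < D0_of k alpha Dinf h0 x)
  by (intros; now apply D0_of_pos).
rewrite coincide_T2_iff. split.
- intros HS. destruct (similarity_profile _ _ _ _ _ _ _ _ _ Hal Hsim (proj1 HS))
    as (a & b & E & C & Ha & HP).
  apply (solves_P1_profile_iff alpha Hal a b E C T s r Ha HP) in HS.
  destruct HS as [HM HE].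
  apply (robin_condition_iff k alpha Dinf h0 a) in HE; auto; [|apply HM].
  (* The face temperature is known only as [- D0_of a] with [a] still undetermined; the root of the
     Robin equation is what identifies [a] with [xi]. *)
  apply (mushy_coefficients_iff k rho c ell alpha gamma eps a b E C
    (D0_of k alpha Dinf h0 a)) in HM; auto.
  destruct HM as (Ha2 & Hb & HC).
  apply P1_P2_equation_iff in Ha2; auto.
  unfold D0. rewrite (Huniq a (conj Ha Ha2)). now rewrite <- HC, <- Hb, <- HE.
- intros HP.
  apply (solves_P1_profile_iff alpha Hal _ _ _ _ T s r Hxi HP).
  assert (HM : mushy_coefficients k rho ell alpha gamma eps
      xi (mu2 gamma D0 xi) (- D0) (D0 / erf xi)).
  { apply (mushy_coefficients_iff k rho c ell alpha gamma eps) with D0; auto.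
    - now apply HD0.
    - split; [|easy]. now apply P1_P2_equation_iff. }
  split; [exact HM|]. apply robin_condition_iff with xi; auto. apply HM.
Qed.

(** * Closed forms and the threshold for [h0] *)

Lemma similarity_T2 (alpha D0 a b : R) :
  similarity alpha (T2 alpha D0 a) (front alpha a) (front alpha b).
Proof.
exists (fun y => - D0 * (1 - erf y / erf a)), a, b. split; [easy|reflexivity].
Qed.

Lemma T1_eq_T2 (k alpha Dinf h0 xi x t : R) :
  0 < k -> 0 < alpha -> 0 < h0 -> 0 < xi ->
  T1 k alpha Dinf h0 xi x t = T2 alpha (D0_of k alpha Dinf h0 xi) xi x t.
Proof.
intros Hk Ha Hh Hxi. unfold T1, T2, D0_of.
assert (Hq : 0 < sqrt (PI * alpha))
  by (apply sqrt_lt_R0, Rmult_lt_0_compat; [apply PI_RGT_0|exact Ha]).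
pose proof (erf_pos xi Hxi) as He.
f_equal. f_equal. set (y := erf xi) in *. clearbody y.
assert (0 < h0 * sqrt (PI * alpha) * y) by (repeat apply Rmult_lt_0_compat; lra).
field. repeat split; lra.
Qed.

Lemma mu1_eq_mu2 (k alpha gamma Dinf h0 xi : R) :
  0 < k -> 0 < alpha -> 0 < h0 -> 0 < Dinf -> 0 < xi ->
  mu1 k alpha gamma Dinf h0 xi = mu2 gamma (D0_of k alpha Dinf h0 xi) xi.
Proof.
intros Hk Ha Hh HD Hxi. unfold mu1, mu2, D0_of.
rewrite sqrt_mult by (pose proof PI_RGT_0; lra).
pose proof sqrt_PI_pos as Hp. pose proof (sqrt_lt_R0 _ Ha) as Hsa.
pose proof (erf_pos xi Hxi) as He. pose proof (exp_pos (xi ^ 2)) as Hw.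
set (w := exp (xi ^ 2)) in *. set (y := erf xi) in *. clearbody w y.
assert (0 < h0 * (sqrt PI * sqrt alpha) * y)
  by (repeat apply Rmult_lt_0_compat; lra).
f_equal. field. repeat split; lra.
Qed.

(** Squaring the hypothesis gives X < (h0 Dinf)^2. The two sides of the conclusion are these numbers
    times the common positive factor c / (h0^2 Dinf ell sqrt PI). *)
Lemma robin_threshold (k rho c ell gamma Dinf h0 eps alpha : R) :
  0 < k -> 0 < rho -> 0 < c -> 0 < ell -> 0 < gamma -> 0 < Dinf -> 0 < h0 ->
  eps < 1 -> alpha = k / (rho * c) ->
  h0 > 1 / Dinf * sqrt (gamma * (1 - eps) * rho * ell * k / 2) ->
  robin_offset k alpha h0 ^ 2 * (gamma * (1 - eps) * sqrt PI / (2 * Dinf))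
    < Dinf * c / (ell * sqrt PI).
Proof.
intros Hk Hrho Hc Hell Hgamma HD Hh Heps Halpha Hineq.
set (X := gamma * (1 - eps) * rho * ell * k / 2) in *.
assert (HX : 0 < X)
  by (unfold X; apply Rdiv_lt_0_compat; [repeat apply Rmult_lt_0_compat; lra|lra]).
assert (H1 : sqrt X < h0 * Dinf).
{ apply Rmult_lt_reg_l with (/ Dinf); [now apply Rinv_0_lt_compat|].
  replace (/ Dinf * (h0 * Dinf)) with h0 by (field; lra). lra. }
assert (H2 : X < (h0 * Dinf) ^ 2).
{ rewrite <- (pow2_sqrt X) by lra. pose proof (sqrt_pos X). nra. }
pose proof PI_RGT_0 as HPI. pose proof sqrt_PI_pos as Hp.
assert (Hal : 0 < alpha)
  by (rewrite Halpha; apply Rdiv_lt_0_compat; [lra|now apply Rmult_lt_0_compat]).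
assert (HK : robin_offset k alpha h0 ^ 2 = k * rho * c / (h0 ^ 2 * sqrt PI ^ 2)).
{ unfold robin_offset. unfold Rdiv at 1.
  rewrite Rpow_mult_distr, pow_inv, Rpow_mult_distr, pow2_sqrt, pow2_sqrt
    by (first [lra | apply Rmult_le_pos; lra]).
  rewrite Halpha. field. repeat split; lra. }
rewrite HK.
apply Rle_lt_trans with (X * (c / (h0 ^ 2 * Dinf * ell * sqrt PI))).
- right. unfold X. field. repeat split; lra.
- apply Rlt_le_trans with ((h0 * Dinf) ^ 2 * (c / (h0 ^ 2 * Dinf * ell * sqrt PI))).
  + apply Rmult_lt_compat_r; [|exact H2].
    apply Rdiv_lt_0_compat; [exact Hc|].
    repeat apply Rmult_lt_0_compat; try lra.
  + right. field. repeat split; lra.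
Qed.

(** * Equivalence of the Robin and fixed-temperature problems *)

Theorem theorem4 (k rho c ell gamma Dinf h0 eps alpha : R)
  (Hk : 0 < k) (Hrho : 0 < rho) (Hc : 0 < c) (Hell : 0 < ell)
  (Hgamma : 0 < gamma) (HDinf : 0 < Dinf) (Hh0 : 0 < h0) (Heps : 0 < eps < 1)
  (Halpha : alpha = k / (rho * c))
  (Hineq : h0 > 1 / Dinf * sqrt (gamma * (1 - eps) * rho * ell * k / 2)) :
  exists xi xi' : R,
    let D0 := D0_of k alpha Dinf h0 xi in
    unique (fun x => 0 < x /\ P1_equation k c ell alpha gamma eps Dinf h0 x) xi /\
    0 < D0 /\
    unique (fun x => 0 < x /\ P2_equation c ell gamma eps D0 x) xi' /\
    xi' = xi /\
    (forall x, 0 < x ->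
       (P1_equation k c ell alpha gamma eps Dinf h0 x <->
        P2_equation c ell gamma eps (D0_of k alpha Dinf h0 x) x)) /\
    solves_P1 k rho ell alpha gamma eps Dinf h0
      (T1 k alpha Dinf h0 xi) (front alpha xi)
      (front alpha (mu1 k alpha gamma Dinf h0 xi)) /\
    solves_P2 k rho ell alpha gamma eps D0
      (T2 alpha D0 xi') (front alpha xi') (front alpha (mu2 gamma D0 xi')) /\
    coincide
      (T1 k alpha Dinf h0 xi) (front alpha xi)
      (front alpha (mu1 k alpha gamma Dinf h0 xi))
      (T2 alpha D0 xi') (front alpha xi') (front alpha (mu2 gamma D0 xi')) /\
    (forall (T : R -> R -> R) (s r : R -> R), similarity alpha T s r ->
       (solves_P1 k rho ell alpha gamma eps Dinf h0 T s r <->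
        coincide T s r
          (T1 k alpha Dinf h0 xi) (front alpha xi)
          (front alpha (mu1 k alpha gamma Dinf h0 xi))) /\
       (solves_P2 k rho ell alpha gamma eps D0 T s r <->
        coincide T s r
          (T2 alpha D0 xi') (front alpha xi')
          (front alpha (mu2 gamma D0 xi'))) /\
       (solves_P1 k rho ell alpha gamma eps Dinf h0 T s r <->
        solves_P2 k rho ell alpha gamma eps D0 T s r)).
Proof.
assert (Hal : 0 < alpha)
  by (rewrite Halpha; apply Rdiv_lt_0_compat; [lra|now apply Rmult_lt_0_compat]).
pose proof (robin_offset_pos k alpha h0 Hk Hal Hh0) as HK.
assert (HB : forall D, 0 < D -> 0 <= gamma * (1 - eps) * sqrt PI / (2 * D)).
{ intros D HD. left. pose proof sqrt_PI_pos.
  apply Rdiv_lt_0_compat; [repeat apply Rmult_lt_0_compat|]; lra. }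
destruct (front_lhs_root (robin_offset k alpha h0)
  (gamma * (1 - eps) * sqrt PI / (2 * Dinf)) (Dinf * c / (ell * sqrt PI)))
  as (xi & Hxi & Hroot); [exact HK|now apply HB| |].
{ apply robin_threshold with rho; tauto. }
apply P1_equationE in Hroot; auto.
exists xi, xi. intros D0.
assert (HD0 : 0 < D0) by now apply D0_of_pos.
assert (HU1 : unique (fun x => 0 < x /\
  P1_equation k c ell alpha gamma eps Dinf h0 x) xi).
{ split; [now split|]. intros y [Hy Hy1].
  apply P1_equationE in Hroot; auto. apply P1_equationE in Hy1; auto.
  rewrite <- Hy1 in Hroot. apply front_lhs_inj in Hroot; auto. lra. }
(* Here [D0] is frozen at [xi], whereas the equivalence of equations at another point y involves
   [D0_of y]. It therefore gives only the root; uniqueness comes from injectivity of [front_lhs]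
   with K = 0. *)
assert (HU2 : unique (fun x => 0 < x /\ P2_equation c ell gamma eps D0 x) xi).
{ assert (Hroot2 : P2_equation c ell gamma eps D0 xi)
    by now apply P1_P2_equation_iff.
  split; [now split|]. intros y [Hy Hy2].
  apply P2_equationE in Hroot2; auto. apply P2_equationE in Hy2; auto.
  rewrite <- Hy2 in Hroot2. apply front_lhs_inj in Hroot2; auto. lra. }
assert (HT : T1 k alpha Dinf h0 xi = T2 alpha D0 xi).
{ apply functional_extensionality. intros x.
  apply functional_extensionality. intros t. now apply T1_eq_T2. }
rewrite HT, mu1_eq_mu2 by easy. fold D0.
assert (H1 : forall T s r, similarity alpha T s r ->
  solves_P1 k rho ell alpha gamma eps Dinf h0 T s r <->
  coincide T s r (T2 alpha D0 xi) (front alpha xi) (front alpha (mu2 gamma D0 xi))).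
{ intros T s r. now apply similarity_solves_P1_iff with c. }
assert (H2 : forall T s r, similarity alpha T s r ->
  solves_P2 k rho ell alpha gamma eps D0 T s r <->
  coincide T s r (T2 alpha D0 xi) (front alpha xi) (front alpha (mu2 gamma D0 xi))).
{ intros T s r. now apply similarity_solves_P2_iff with c. }
assert (Hrefl : coincide (T2 alpha D0 xi) (front alpha xi) (front alpha (mu2 gamma D0 xi))
  (T2 alpha D0 xi) (front alpha xi) (front alpha (mu2 gamma D0 xi))) by now split.
split; [exact HU1|]. split; [exact HD0|]. split; [exact HU2|].
split; [reflexivity|].
split; [intros x Hx; now apply P1_P2_equation_iff|].
(* The closed forms are similarity triples coinciding with themselves, so the classification read
   backwards shows that they are solutions. *)
split; [now apply H1; [apply similarity_T2|]|].
split; [now apply H2; [apply similarity_T2|]|].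
split; [exact Hrefl|].
intros T s r Hsim.
rewrite (H1 T s r Hsim), (H2 T s r Hsim). tauto.
Qed.
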